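(* Let $(X,b)$ be a connected canonically compactifiable graph, let $m$ be a finite measure on $X$, and let $\sigma$ be a pseudo metric on $X$ which is intrinsic with respect to $m$. Then $X$ is totally bounded with respect to $\sigma$.
   Context: A graph $G=(X,b)$ consists of a nonempty countable set $X$ (nodes) and a symmetric function $b:X\times X\to[0,\infty)$ with $b(x,x)=0$ for all $x$ and $\sum_{y\in X}b(x,y)<\infty$ for all $x\in X$. (Local finiteness is not assumed.) Two nodes $x,y$ are connected if there is a finite sequence $x=x_0,\ldots,x_n=y$ with $b(x_k,x_{k+1})>0$ for all $0\le k<n$; the graph is connected if all its nodes are connected to each other. The Dirichlet energy of $f:X\to\mathbb{C}$ is $\tilde{Q}(f)=\frac12\sum_{x,y\in X}b(x,y)|f(x)-f(y)|^2\in[0,\infty]$, and $\mathfrak{D}(G)=\{f:X\to\mathbb{C}\mid \tilde{Q}(f)<\infty\}$. The graph is canonically compactifiable if $\mathfrak{D}(G)\subseteq\ell^\infty(X)$, i.e. every function of finite energy is bounded. A pseudo metric on $X$ is a symmetric function $\sigma:X\times X\to[0,\infty)$ that vanishes on the diagonal and satisfies the triangle inequality. A measure $m$ on $X$ is a map $\mathcal{P}(X)\to[0,\infty]$ of the form $m(A)=\sum_{x\in A}m(\{x\})$ with $m(\{x\})\in(0,\infty)$ for every $x\in X$; it is finite if $m(X)<\infty$. The pseudo metric $\sigma$ is intrinsic with respect to $m$ if $\frac12\sum_{y\in X}b(x,y)\sigma(x,y)^2\le m(\{x\})$ for all $x\in X$. $X$ is totally bounded with respect to $\sigma$ if for every $\varepsilon>0$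 there is a finite set $S\subseteq X$ such that $\inf_{s\in S}\sigma(x,s)<\varepsilon$ for all $x\in X$. *)

(* Defs.v *)
From HB Require Import structures.
From mathcomp Require Import all_boot all_order all_algebra.
From mathcomp Require Import all_classical all_reals all_analysis.
From mathcomp Require Import complex.

Set Implicit Arguments.
Unset Strict Implicit.
Unset Printing Implicit Defensive.
Import Order.TTheory GRing.Theory Num.Theory.

Local Open Scope classical_set_scope.
Local Open Scope ring_scope.

(* Only nonnegative terms are summed, so the unordered sums [esum], with values
   in [\bar R], are the intended ones. *)

Section Graph.
Context {R : realType} {X : countType}.
Implicit Types (b sigma : X -> X -> R) (f : X -> R[i]) (m : set X -> \bar R).

Record is_graph b : Prop := IsGraph {
  graph_nonempty : [set: X] !=set0;
  graph_ge0 : forall x y, 0 <= b x y;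
  graph_sym : forall x y, b x y = b y x;
  graph_diag : forall x, b x x = 0;
  graph_summable : forall x, ((\esum_(y in [set: X]) (b x y)%:E) < +oo)%E
}.

(* The nodes of the finite sequence from x to y are x followed by p. *)
Definition nodes_connected b (x y : X) : Prop :=
  exists p : seq X, path (fun u v => 0 < b u v) x p /\ last x p = y.

Definition graph_connected b : Prop := forall x y, nodes_connected b x y.

(* The modulus is the R-valued [normc], since the norm [`|z|] of z : R[i]
   lives in R[i]. *)
Definition dirichlet_energy b f : \bar R :=
  ((2^-1)%:E * (\esum_(xy in [set: X * X])
     (b xy.1 xy.2 * ComplexField.Normc.normc (f xy.1 - f xy.2) ^+ 2)%:E))%E.

Definition finite_energy b : set (X -> R[i]) :=
  [set f | (dirichlet_energy b f < +oo)%E].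

Definition ell_infty : set (X -> R[i]) :=
  [set f | exists M : R, forall x, ComplexField.Normc.normc (f x) <= M].

Definition canonically_compactifiable b : Prop :=
  finite_energy b `<=` ell_infty.

Record is_pseudometric sigma : Prop := IsPseudometric {
  pseudometric_ge0 : forall x y, 0 <= sigma x y;
  pseudometric_sym : forall x y, sigma x y = sigma y x;
  pseudometric_diag : forall x, sigma x x = 0;
  pseudometric_triangle :
    forall x y z, sigma x z <= sigma x y + sigma y z
}.

Record is_node_measure m : Prop := IsNodeMeasure {
  node_measure_gt0 : forall x, (0 < m [set x])%E;
  node_measure_lty : forall x, (m [set x] < +oo)%E;
  node_measureE : forall A : set X, m A = \esum_(x in A) m [set x]
}.

Definition is_finite_node_measure m : Prop := (m [set: X] < +oo)%E.

Definition intrinsic b m sigma : Prop := forall x,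
  ((2^-1)%:E * (\esum_(y in [set: X]) (b x y * sigma x y ^+ 2)%:E)
     <= m [set x])%E.

(* The infimum is taken in [\bar R], so that it is +oo when S is empty;
   the real-valued [inf] would give 0. *)
Definition totally_bounded sigma : Prop :=
  forall eps : R, 0 < eps ->
  exists2 S : set X, finite_set S &
    forall x, (ereal_inf [set (sigma x s)%:E | s in S] < eps%:E)%E.

End Graph.

(* Main.v *)
Require Import Defs.
From mathcomp Require Import all_boot all_order all_algebra.
From mathcomp Require Import all_classical all_reals all_analysis.
From mathcomp Require Import complex lra.

(** If X is not totally bounded, then for some [delta > 0] there are infinitely
    many pairwise disjoint balls [B_n] of radius [delta] centred at [u_n]. Since
    [m] is finite, the centres can be chosen so far out that
    [n^2 m(B_n) <= 2^-(n+1)]. The function that equals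
    [n (delta - sigma(x, u_n))] on [B_n] and 0 elsewhere is unbounded, but
    [|f x - f y| <= (c x + c y) sigma(x, y)] with [c = n] on [B_n], so
    intrinsicness bounds its energy by [4 \sum_n n^2 m(B_n)]. *)

Set Implicit Arguments.
Unset Strict Implicit.
Unset Printing Implicit Defensive.
Import Order.TTheory GRing.Theory Num.Theory.

Local Open Scope classical_set_scope.
Local Open Scope ring_scope.

(** Choice against the whole history: [hist n] lists the terms picked before stage [n], and the
    hypothesis is applied to that list. *)
Lemma greedy_sequence (T : eqType) (P : nat -> T -> Prop) (r : T -> T -> Prop) :
  (forall n (s : seq T), exists x, P n x /\ forall y, y \in s -> r x y) ->
  exists u : nat -> T,
    (forall n, P n (u n)) /\ (forall n k, (k < n)%N -> r (u n) (u k)).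
Proof.
move=> ex; pose g n s := sval (cid (ex n s)).
have gP n s := svalP (cid (ex n s)).
pose fix hist (n : nat) : seq T := if n is n'.+1 then g n' (hist n') :: hist n' else [::].
have uH n k : (k < n)%N -> g k (hist k) \in hist n.
  elim: n => // n IH; rewrite ltnS leq_eqVlt => /orP[/eqP->|/IH kn] /=.
    by rewrite mem_head.
  by rewrite inE kn orbT.
exists (fun n => g n (hist n)); split=> [n|n k kn]; first exact: (gP _ _).1.
exact: (gP n (hist n)).2 _ (uH _ _ kn).
Qed.

(** * Sums of nonnegative families *)

Section esum.
Variables (R : realType) (T : choiceType).
Implicit Type a : T -> \bar R.
Local Open Scope ereal_scope.

Lemma esum_le_mull (I : set T) a (c : R) : (0 <= c)%R ->
  (forall x, 0 <= a x) ->
  \esum_(x in I) (c%:E * a x) <= c%:E * \esum_(x in I) a x.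
Proof.
move=> c0 a0; apply: ge_ereal_sup => _ [F FI <-].
rewrite -ge0_mule_fsumr//; apply: lee_wpmul2l; first by rewrite lee_fin.
by apply: ereal_sup_ubound; exists F.
Qed.

Lemma esum_subset (I J : set T) a : I `<=` J -> (forall x, 0 <= a x) ->
  \esum_(x in I) a x <= \esum_(x in J) a x.
Proof.
move=> IJ a0; rewrite (@esumID _ _ I J)// (setIidr IJ) leeDl// esum_ge0//.
Qed.

(** Some finite partial sum comes within [e] of the total; it is finite, so it can be cancelled,
    leaving the sum over the complement. *)
Lemma esum_tail_lt a (e : R) : (0 < e)%R -> (forall x, 0 <= a x) ->
  \esum_(x in [set: T]) a x < +oo ->
  exists2 F : set T, finite_set F & \esum_(x in ~` F) a x < e%:E.
Proof.
move=> e0 a0 afin.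
have Sfin : \esum_(x in [set: T]) a x \is a fin_num.
  by rewrite ge0_fin_numE// esum_ge0.
have [_ [F [finF _] <-] SF] := ub_ereal_sup_adherent e0 Sfin.
exists F => //; move: SF; rewrite -/(esum _ _).
rewrite (@esumID _ _ F)// !setTI (esum_fset finF)// in Sfin *.
rewrite lteBlDr// lteD2lE//.
by move: Sfin; rewrite fin_numD => /andP[].
Qed.

End esum.

(** * Energy bounds from an intrinsic pseudo metric *)

Section graph.
Variables (R : realType) (X : countType).
Variables (b sigma : X -> X -> R) (m : set X -> \bar R).
Hypothesis b_graph : is_graph b.
Hypothesis m_measure : is_node_measure m.
Hypothesis sigma_pseudometric : is_pseudometric sigma.

Let m_ge0 x : (0 <= m [set x])%E.
Proof. exact/ltW/(node_measure_gt0 m_measure). Qed.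

(** Since [(c x + c y)^2 <= 2 (c x)^2 + 2 (c y)^2], each energy term is at most [a x y + a y x].
    Summing [a x y] over [y] first, intrinsicness leaves at most [4 (c x)^2 m {x}]. *)
Lemma finite_energy_lipschitz (c g : X -> R) :
  intrinsic b m sigma ->
  (forall x y, `|g x - g y| <= (c x + c y) * sigma x y) ->
  (\esum_(x in [set: X]) ((c x ^+ 2)%:E * m [set x]) < +oo)%E ->
  finite_energy b (fun x => real_complex R (g x)).
Proof.
move=> intr lip cfin; rewrite /finite_energy /= /dirichlet_energy.
have b0 := graph_ge0 b_graph.
have bs0 x y : 0 <= b x y * sigma x y ^+ 2 by rewrite mulr_ge0 ?sqr_ge0.
have c0 x : 0 <= 2 * c x ^+ 2 by rewrite mulr_ge0 ?sqr_ge0.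
pose a x y : \bar R := (2 * c x ^+ 2 * (b x y * sigma x y ^+ 2))%:E.
have a0 x y : (0 <= a x y)%E.
  by rewrite lee_fin mulr_ge0.
have afin : (\esum_(xy in [set: X * X]) a xy.1 xy.2 < +oo)%E.
  have := esum_esum (I := setT) (J := fun=> setT) (fun x y _ _ => a0 x y).
  rewrite (_ : [set: X] `*`` _ = setT); last by apply/seteqP; split.
  move=> <-.
  apply: (@le_lt_trans _ _ (\esum_(x in [set: X])
    (4%:E * ((c x ^+ 2)%:E * m [set x]))))%E.
    apply: le_esum => x _.
    apply: le_trans (esum_le_mull (a := fun y => (b x y * sigma x y ^+ 2)%:E)
      _ (c0 x) (bs0 x)) _.
    rewrite (_ : 2 * c x ^+ 2 = 4 * c x ^+ 2 * 2^-1); last by lra.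
    rewrite EFinM -muleA [X in (_ <= X)%E]muleA -EFinM.
    apply: lee_wpmul2l; last exact: intr.
    by rewrite lee_fin mulr_ge0 ?sqr_ge0.
  apply: le_lt_trans (esum_le_mull _ _ _) _ => //.
    by move=> x; rewrite mule_ge0// lee_fin sqr_ge0.
  by rewrite lte_mul_pinfty.
have aswap : (\esum_(xy in [set: X * X]) a xy.2 xy.1 =
              \esum_(xy in [set: X * X]) a xy.1 xy.2)%E.
  rewrite (@reindex_esum _ _ _ setT setT (fun xy => (xy.2, xy.1)))//.
  split=> //; last by move=> [x y] _; exists (y, x).
  by move=> [x y] [x' y'] _ _ [-> ->].
rewrite lte_mul_pinfty//.
apply: (@le_lt_trans _ _ (\esum_(xy in [set: X * X])
  (a xy.1 xy.2 + a xy.2 xy.1)))%E; last first.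
  by rewrite esumD// aswap lte_add_pinfty.
apply: le_esum => -[x y] _ /=; rewrite /a -EFinD lee_fin.
rewrite (graph_sym b_graph y x) (pseudometric_sym sigma_pseudometric y x).
rewrite -mulrDl [leRHS]mulrCA; apply: ler_wpM2l; first exact: b0.
(* The imaginary part is 0, so [normc] becomes the real absolute value. *)
rewrite subr0 expr0n addr0 sqrtr_sqr.
apply: (@le_trans _ _ (((c x + c y) * sigma x y) ^+ 2)).
  by rewrite lerXn2r ?nnegrE// (le_trans _ (lip x y)).
rewrite exprMn; apply: ler_wpM2r; first exact: sqr_ge0.
by have := sqr_ge0 (c x - c y); nra.
Qed.

(** * The weighted bump function of a separated sequence *)

Section bump.
Variables (u : nat -> X) (delta : R).
Hypothesis u_separated :
  forall n k, (k < n)%N -> 2 * delta <= sigma (u n) (u k).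

Let ball n : set X := [set x | sigma x (u n) < delta].

(** A common point would put two centres at distance less than [2 * delta]. *)
Let ball_inj n k x : ball n x -> ball k x -> n = k.
Proof.
have sym := pseudometric_sym sigma_pseudometric.
have tri := pseudometric_triangle sigma_pseudometric (u n) x (u k).
rewrite /ball/= => xn xk; rewrite (sym (u n) x) in tri.
have [kn|nk|//] := ltngtP k n.
  by exfalso; have := u_separated kn; lra.
by exfalso; have := u_separated nk; rewrite sym; lra.
Qed.

(* The index is 0 outside all balls, where the bump function must vanish. *)
Let index x : nat := xget 0%N [set n | ball n x].

Let bump x : R := (index x)%:R * (delta - sigma x (u (index x))).

Let index_ball n x : ball n x -> index x = n.
Proof.
by move=> xn; exact: ball_inj (@xgetI _ 0%N [set k | ball k x] n xn) xn.
Qed.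

(** Index 0 is excluded because it is also the default value outside all balls. *)
Let ball_index n x : index x = n -> n != 0%N -> ball n x.
Proof. by move=> <-; rewrite /index; case: xgetP => // y ->. Qed.

(** If [index x] is not 0, then [x] lies in its ball and [y] outside it, so [delta] is at most the
    distance from [y] to the centre, and the triangle inequality applies. *)
Let bump_le x y : index x != index y ->
  0 <= bump x <= (index x)%:R * sigma x y.
Proof.
rewrite /bump; have [->|x0 xy] := eqVneq (index x) 0%N.
  by rewrite !mul0r lexx.
have xB := ball_index erefl x0.
have : ~ ball (index x) y by move=> /index_ball/eqP; rewrite eq_sym (negbTE xy).
move=> /negP; rewrite -leNgt => yB.
have := pseudometric_triangle sigma_pseudometric y x (u (index x)).
rewrite (pseudometric_sym sigma_pseudometric y x) => tri.
move: xB; rewrite /ball/= => xB.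
apply/andP; split; first by rewrite mulr_ge0//; lra.
by apply: ler_wpM2l => //; lra.
Qed.

Let bump_lipschitz x y :
  `|bump x - bump y| <= ((index x)%:R + (index y)%:R) * sigma x y.
Proof.
have s0 := pseudometric_ge0 sigma_pseudometric x y.
have sym := pseudometric_sym sigma_pseudometric.
have [xy|xy] := eqVneq (index x) (index y); last first.
  (* With distinct indices both values are nonnegative, so the larger one bounds the difference. *)
  have /andP[] := bump_le xy; rewrite eq_sym in xy.
  have /andP[] := bump_le xy; rewrite (sym y x) => ? ? ? ?.
  by rewrite ler_norml; apply/andP; split; lra.
rewrite /bump xy -mulrBr normrM ger0_norm// mulrDl.
apply: (@le_trans _ _ ((index y)%:R * sigma x y)); last first.
  by rewrite lerDl mulr_ge0.
apply: ler_wpM2l => //.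
have := pseudometric_triangle sigma_pseudometric x y (u (index y)).
have := pseudometric_triangle sigma_pseudometric y x (u (index y)).
by rewrite (sym y x) ler_norml => ? ?; apply/andP; split; lra.
Qed.

Lemma compactifiable_no_small_balls :
  canonically_compactifiable b -> intrinsic b m sigma -> 0 < delta ->
  ~ forall n, (m (ball n) <= (1 / (2 ^ n.+1)%:R / (n ^ 2).+1%:R)%:E)%E.
Proof.
move=> comp intr d0 small.
have : finite_energy b (fun x => real_complex R (bump x)).
  apply: finite_energy_lipschitz intr bump_lipschitz _.
  have w0 x : (0 <= ((index x)%:R ^+ 2)%:E * m [set x] :> \bar R)%E.
    by rewrite mule_ge0// lee_fin sqr_ge0.
  (* The sum is regrouped along the level sets of [index]; level [n] will contribute at most
     [1 / 2^(n+1)]. *)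
  rewrite (_ : [set: X] = \bigcup_n [set x | index x = n]); last first.
    by apply/seteqP; split=> // x _; exists (index x).
  rewrite nneseries_sum_bigcup//; last first.
    by move=> i j _ _ [x [/= <- <-]].
  apply: le_lt_trans (ltry 1); apply: le_trans (epsilon_trick0 predT ler01).
  apply: lee_nneseries => [n _ _|n _]; first exact: esum_ge0.
  (* Level 0 contains every point outside the balls and its mass is not controlled by [small], but
     its weight is 0. *)
  have [->|n0] := eqVneq n 0%N.
    rewrite esum1 ?lee_fin// => x /= ->.
    by rewrite expr0n mul0e.
  rewrite (eq_esum (b := fun x => ((n%:R ^+ 2)%:E * m [set x])%E)); last first.
    by move=> x /= ->.
  apply: le_trans (esum_le_mull _ (sqr_ge0 _) m_ge0) _.
  have le_ball : (\esum_(x in [set x | index x = n]) m [set x] <= m (ball n))%E.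
    rewrite (node_measureE m_measure (ball n)); apply: esum_subset => //.
    by move=> x /ball_index; apply.
  apply: le_trans (lee_wpmul2l _ (le_trans le_ball (small n))) _.
    by rewrite lee_fin sqr_ge0.
  rewrite -EFinM lee_fin mulrCA -[leRHS]mulr1; apply: ler_wpM2l => //.
  by rewrite ler_pdivrMr ?ltr0n// mul1r -natrX ler_nat.
move=> /comp[M boundM].
(* The bump has height [n * delta] at [u n], which exceeds [M] for such an [n]. *)
have [n Mn] : exists n : nat, M / delta < n%:R.
  exists (Num.bound `|M / delta|).
  exact: le_lt_trans (ler_norm _) (archi_boundP (normr_ge0 _)).
have := boundM (u n); rewrite /= expr0n addr0 sqrtr_sqr.
have -> : bump (u n) = n%:R * delta.
  have un : ball n (u n) by rewrite /ball/= (pseudometric_diag sigma_pseudometric).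
  by rewrite /bump (index_ball un) (pseudometric_diag sigma_pseudometric) subr0.
move=> /(le_trans (ler_norm _)); rewrite -ler_pdivlMr//.
by rewrite leNgt Mn.
Qed.

End bump.

End graph.

Theorem theorem1 (R : realType) (X : countType)
    (b : X -> X -> R) (m : set X -> \bar R) (sigma : X -> X -> R)
    (b_graph : is_graph b)
    (b_connected : graph_connected b)
    (b_compactifiable : canonically_compactifiable b)
    (m_measure : is_node_measure m)
    (m_finite : is_finite_node_measure m)
    (sigma_pseudometric : is_pseudometric sigma)
    (sigma_intrinsic : intrinsic b m sigma) :
  totally_bounded sigma.
Proof.
move=> eps eps0; apply: contrapT => not_tb.
have m0 x : (0 <= m [set x])%E by exact/ltW/(node_measure_gt0 m_measure).
(* Failure of total boundedness at [eps]: no finite set comes within [eps] of every point. *)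
have far (S : set X) : finite_set S ->
    exists x, forall y, S y -> eps <= sigma x y.
  move=> finS; apply: contrapT => no_far; apply: not_tb; exists S => // x.
  rewrite ltNge; apply/negP => le_inf; apply: no_far; exists x => y Sy.
  by rewrite -lee_fin (le_trans le_inf)//; apply: ereal_inf_lbound; exists y.
have [u [u_small u_sep]] : exists u : nat -> X,
    (forall n, (m [set x | (sigma x (u n) < eps / 2)%R] <=
       (1 / (2 ^ n.+1)%:R / (n ^ 2).+1%:R)%:E)%E) /\
    (forall n k, (k < n)%N -> 2 * (eps / 2) <= sigma (u n) (u k)).
  apply: (greedy_sequence (P := fun n z =>
    (m [set x | (sigma x z < eps / 2)%R] <=
       (1 / (2 ^ n.+1)%:R / (n ^ 2).+1%:R)%:E)%E)
    (r := fun z y => 2 * (eps / 2) <= sigma z y)) => n s.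
  have e0 : 0 < 1 / (2 ^ n.+1)%:R / (n ^ 2).+1%:R :> R.
    by rewrite !divr_gt0// ltr0n ?expn_gt0.
  have mfin : (\esum_(x in [set: X]) m [set x] < +oo)%E.
    by rewrite -(node_measureE m_measure).
  have [F finF tailF] := esum_tail_lt e0 m0 mfin.
  (* Distance [eps] from [s] separates the new centre from the earlier ones; distance [eps] from [F]
     makes its ball of radius [eps / 2] miss [F], so that its mass is at most the tail. *)
  have finFs : finite_set (F `|` [set` s]).
    by rewrite finite_setU; split=> //; exact: finite_seq.
  have [z zfar] := far _ finFs.
  exists z; split=> [|y ys]; last first.
    by rewrite mulrC divfK ?pnatr_eq0//; apply: zfar; right.
  rewrite (node_measureE m_measure); apply: le_trans (ltW tailF).
  apply: esum_subset => // x /= xz Fx.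
  have := zfar x (or_introl Fx).
  by rewrite (pseudometric_sym sigma_pseudometric z x); lra.
apply: (compactifiable_no_small_balls b_graph m_measure sigma_pseudometric
  u_sep b_compactifiable sigma_intrinsic _ u_small).
by rewrite divr_gt0.
Qed.
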